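(* Let $\mathcal{S}$ be a unipotent numerical monoid in $G$ and let $A\in\mathcal{S}^*$. Then: (1) $\mathtt{Ap}_l(\mathcal{S},A)\cup\{A\}$ is a generating set for the monoid $\mathcal{S}$; (2) $\mathtt{Ap}_r(\mathcal{S},A)\cup\{A\}$ is a generating set for the monoid $\mathcal{S}$.
   Context: Setting: $n$ is a positive integer, $\mathbf{U}(n,\mathbb{C})$ is the group of upper triangular unipotent $n\times n$ complex matrices, and $G$ is a (Zariski) closed subgroup of it. $G_{\mathbb{Z}}$ is the group of matrices in $G$ with integer entries, and $G(\mathbb{N})$ is the monoid of matrices in $G_{\mathbb{Z}}$ all of whose entries lie in $\mathbb{N}=\{0,1,2,\dots\}$. Standing assumptions: the monoid $G(\mathbb{N})$ is finitely generated and $G_{\mathbb{Z}}$ is its group completion. $\mathbf{1}_n$ is the identity matrix. A unipotent numerical monoid in $G$ is a finitely generated submonoid $\mathcal{S}\subseteq G(\mathbb{N})$ (containing $\mathbf{1}_n$) such that $G(\mathbb{N})\setminus\mathcal{S}$ is finite; $\mathcal{S}^*:=\mathcal{S}\setminus\{\mathbf{1}_n\}$. For $A\in\mathcal{S}^*$ the left and right Apéry sets are $\mathtt{Ap}_l(\mathcal{S},A):=\{B\in\mathcal{S}\mid A^{-1}B\notin\mathcal{S}\}$ and $\mathtt{Ap}_r(\mathcal{S},A):=\{B\in\mathcal{S}\mid BA^{-1}\notin\mathcal{S}\}$. A subset is a generating set for $\mathcal{S}$ if every element of $\mathcal{S}$ is a finite (possibly empty) product of elements of the subset. *)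

(* Defs.v *)
From HB Require Import structures.
From mathcomp Require Import all_boot all_order all_algebra.
From mathcomp Require Import boolp classical_sets cardinality reals.
From mathcomp Require Export complex.
From mathcomp Require mpoly.

Set Implicit Arguments.
Unset Strict Implicit.
Unset Printing Implicit Defensive.

Import GRing.Theory.
Local Open Scope classical_set_scope.
Local Open Scope ring_scope.

(* The complex numbers are [R[i]] for [R : realType]. *)

Definition unipotent_upper (R : realType) (n : nat) : set 'M[R[i]]_n :=
  [set A | (forall i : 'I_n, A i i = 1) /\
           (forall i j : 'I_n, (j < i)%N -> A i j = 0)].

(* The common zeros of [P], a set of polynomials in the n * n matrix entries;
   [mxvec] is the bijective row-major listing of these entries. *)
Definition zero_locus (R : realType) (n : nat)
    (P : set (mpoly.mpoly (n * n)%N R[i])) : set 'M[R[i]]_n :=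
  [set A | forall p, P p -> mpoly.meval (fun k => mxvec A 0 k) p = 0].

Definition submonoid (R : realType) (n : nat) (M : set 'M[R[i]]_n) : Prop :=
  M 1%:M /\ (forall A B, M A -> M B -> M (A *m B)).

Definition matrix_subgroup (R : realType) (n : nat) (M : set 'M[R[i]]_n) :
    Prop :=
  [/\ M `<=` [set A | A \in unitmx], submonoid M
    & forall A, M A -> M (invmx A)].

Definition closed_unipotent_subgroup (R : realType) (n : nat)
    (G : set 'M[R[i]]_n) : Prop :=
  matrix_subgroup G /\
  exists P, G = @unipotent_upper R n `&` zero_locus P.

Definition integer_points (R : realType) (n : nat) (G : set 'M[R[i]]_n) :
    set 'M[R[i]]_n :=
  [set A | G A /\ forall i j, exists z : int, A i j = z%:~R].

Definition natural_points (R : realType) (n : nat) (G : set 'M[R[i]]_n) :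
    set 'M[R[i]]_n :=
  [set A | integer_points G A /\ forall i j, exists k : nat, A i j = k%:R].

Definition generating_set (R : realType) (n : nat) (M T : set 'M[R[i]]_n) :
    Prop :=
  T `<=` M /\
  forall B, M B -> exists s : seq 'M[R[i]]_n,
    (forall C, C \in s -> T C) /\ B = \big[mulmx/1%:M]_(C <- s) C.

Definition finitely_generated (R : realType) (n : nat) (M : set 'M[R[i]]_n) :
    Prop :=
  exists T, finite_set T /\ generating_set M T.

(* Only the values of [f] on [M] matter. *)
Definition monoid_hom_on (R : realType) (n : nat) (H : groupType)
    (M : set 'M[R[i]]_n) (f : 'M[R[i]]_n -> H) : Prop :=
  f 1%:M = 1%g /\
  (forall A B, M A -> M B -> f (A *m B) = (f A * f B)%g).

(* The universal property: the inclusion of the monoid [M] in the group [K] is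
   initial among the monoid homomorphisms from [M] to groups. *)
Definition group_completion (R : realType) (n : nat) (M K : set 'M[R[i]]_n) :
    Prop :=
  [/\ submonoid M, matrix_subgroup K, M `<=` K
    & forall (H : groupType) (f : 'M[R[i]]_n -> H), monoid_hom_on M f ->
      exists g : 'M[R[i]]_n -> H,
        [/\ monoid_hom_on K g, (forall A, M A -> g A = f A)
          & forall g' : 'M[R[i]]_n -> H,
              monoid_hom_on K g' -> (forall A, M A -> g' A = f A) ->
              forall A, K A -> g' A = g A]].

Definition unipotent_numerical_monoid (R : realType) (n : nat)
    (G S : set 'M[R[i]]_n) : Prop :=
  [/\ S `<=` natural_points G, submonoid S, finitely_generated S
    & finite_set (natural_points G `\` S)].

Definition nonidentity (R : realType) (n : nat) (S : set 'M[R[i]]_n) :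
    set 'M[R[i]]_n :=
  S `\ 1%:M.

(* [invmx A] is the inverse of [A] only when [A] is invertible, which holds for
   every element of a unipotent numerical monoid. *)
Definition Apery_l (R : realType) (n : nat) (S : set 'M[R[i]]_n)
    (A : 'M[R[i]]_n) : set 'M[R[i]]_n :=
  [set B | S B /\ ~ S (invmx A *m B)].

Definition Apery_r (R : realType) (n : nat) (S : set 'M[R[i]]_n)
    (A : 'M[R[i]]_n) : set 'M[R[i]]_n :=
  [set B | S B /\ ~ S (B *m invmx A)].

(* Main.v *)
From HB Require Import structures.
Require Import Defs.
From mathcomp Require Import all_boot all_order all_algebra.
From mathcomp Require Import boolp classical_sets cardinality reals.
Local Open Scope classical_set_scope.
Local Open Scope ring_scope.

(** Dividing [B] by [A], on the left or on the right, as long as the quotient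
    stays in [S] must stop: writing [A = 1 + N] with [N] nonnegative and nonzero,
    the sum of the entries of [A C] exceeds that of [C] by the sum of the entries
    of [N C], hence at least by that of [N], since [C] has unit diagonal. *)

Set Implicit Arguments.
Unset Strict Implicit.
Unset Printing Implicit Defensive.

Import Order.TTheory GRing.Theory Num.Theory.

(** Lets [big_seq1] and [big_rcons] rewrite matrix products over lists. *)
HB.instance Definition _ (F : pzSemiRingType) (n : nat) :=
  Monoid.isLaw.Build 'M[F]_n 1%:M (@mulmx F n n n)
    (@mulmxA F n n n n) (@mul1mx F n n) (@mulmx1 F n n).

Definition entry_sum (F : nmodType) (n : nat) (A : 'M[F]_n) : F :=
  \sum_i \sum_j A i j.

Lemma entry_sum_tr (F : nmodType) (n : nat) (A : 'M[F]_n) :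
  entry_sum A^T = entry_sum A.
Proof.
rewrite /entry_sum exchange_big /=.
by apply: eq_bigr => i _; apply: eq_bigr => j _; rewrite mxE.
Qed.

(** Unlike upper triangularity, this condition is stable under transposition, so right
    multiplication can be reduced to left multiplication. *)
Definition nonneg_unidiagonal (F : numDomainType) (n : nat) (A : 'M[F]_n) :
    Prop :=
  (forall i j, 0 <= A i j) /\ forall i, A i i = 1.

Lemma nonneg_unidiagonal_tr (F : numDomainType) (n : nat) (A : 'M[F]_n) :
  nonneg_unidiagonal A -> nonneg_unidiagonal A^T.
Proof. by case=> A_ge0 A_diag; split=> *; rewrite mxE. Qed.

Lemma entry_sum_lt_mull (F : numDomainType) (n : nat) (A C : 'M[F]_n) :
  nonneg_unidiagonal A -> nonneg_unidiagonal C -> A != 1%:M ->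
  entry_sum C < entry_sum (A *m C).
Proof.
move=> [A_ge0 A_diag] [C_ge0 C_diag] A_neq1.
have AC_entry i j : (A *m C) i j = C i j + \sum_(k | k != i) A i k * C k j.
  by rewrite mxE (bigD1 i) //= A_diag mul1r.
have entry_ge i j : C i j <= (A *m C) i j.
  by rewrite AC_entry lerDl sumr_ge0 // => k _; rewrite mulr_ge0.
(* If no off-diagonal entry were positive, all would vanish, being nonnegative, and [A] would be the
   identity. *)
have [i [j [ij A_gt0]]] : exists i j, j != i /\ 0 < A i j.
  apply: contrapT => noij; case/eqP: A_neq1; apply/matrixP => i j.
  rewrite mxE; have [<-|ij] := eqVneq i j; first by rewrite A_diag.
  apply: contrapT => Aij; apply: noij; exists i, j.
  by rewrite eq_sym ij lt0r A_ge0 andbT; split=> //; apply/eqP.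
(* Since [j != i], the term [k = j] occurs in the sum; it equals [A i j * C j j = A i j], which is
   positive. *)
have entry_gt : C i j < (A *m C) i j.
  rewrite AC_entry ltrDl (bigD1 j) //= C_diag mulr1 ltr_pwDl //.
  by rewrite sumr_ge0 // => k _; rewrite mulr_ge0.
(* Isolate row [i], then its entry [j]: the inequality is strict there and weak at all other
   entries. *)
rewrite /entry_sum [ltLHS](bigD1 i) // [ltRHS](bigD1 i) //=.
apply: ltr_leD; last by apply: ler_sum => k _; apply: ler_sum.
rewrite [ltLHS](bigD1 j) // [ltRHS](bigD1 j) //=.
by apply: ltr_leD => //; apply: ler_sum.
Qed.

(** Transposition preserves the entry sum and reverses the product. *)
Lemma entry_sum_lt_mulr (F : numDomainType) (n : nat) (A C : 'M[F]_n) :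
  nonneg_unidiagonal A -> nonneg_unidiagonal C -> A != 1%:M ->
  entry_sum C < entry_sum (C *m A).
Proof.
move=> A_nu C_nu A_neq1.
rewrite -[ltLHS]entry_sum_tr -[ltRHS]entry_sum_tr trmx_mul.
apply: entry_sum_lt_mull; [exact: nonneg_unidiagonal_tr.. |].
by apply: contra A_neq1 => /eqP AT1; rewrite -[A]trmxK AT1 trmx1.
Qed.

Section NaturalPoints.

Variables (R : realType) (n : nat) (G : set 'M[R[i]]_n).
Hypothesis G_closed : closed_unipotent_subgroup G.

Lemma natural_points_nonneg_unidiagonal (A : 'M[R[i]]_n) :
  natural_points G A -> nonneg_unidiagonal A.
Proof.
case: G_closed => _ [P GE] [[GA _] A_nat]; split.
  by move=> i j; have [k ->] := A_nat i j; exact: ler0n.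
by move: GA; rewrite GE => -[[]].
Qed.

Lemma natural_points_unitmx (A : 'M[R[i]]_n) :
  natural_points G A -> A \in unitmx.
Proof. by case: G_closed => -[G_unit _ _] _ [[GA _] _]; exact: G_unit. Qed.

(** The order on [R[i]] is not well-founded; integrality of the sums is what makes descent along
    them terminate. *)
Lemma entry_sum_natural (A : 'M[R[i]]_n) :
  natural_points G A -> exists k : nat, entry_sum A = k%:R.
Proof.
case=> _ A_nat.
have natD (x y : R[i]) : (exists k : nat, x = k%:R) ->
    (exists k : nat, y = k%:R) -> exists k : nat, x + y = k%:R.
  by move=> [k ->] [l ->]; exists (k + l)%N; rewrite natrD.
apply: (big_ind (fun x => exists k : nat, x = k%:R)) => //; first by exists 0%N.
move=> i _; apply: (big_ind (fun x => exists k : nat, x = k%:R)) => //.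
by exists 0%N.
Qed.

Lemma entry_sum_ind (S P : set 'M[R[i]]_n) :
  S `<=` natural_points G ->
  (forall B, S B ->
     (forall C, S C -> entry_sum C < entry_sum B -> P C) -> P B) ->
  S `<=` P.
Proof.
move=> S_nat IH B SB; have [k Bk] := entry_sum_natural (S_nat _ SB).
elim/ltn_ind: k B SB Bk => k IHk B SB Bk; apply: IH => // C SC.
have [l Cl] := entry_sum_natural (S_nat _ SC).
by rewrite Bk Cl ltr_nat => lk; apply: IHk lk _ SC Cl.
Qed.

Variables (S : set 'M[R[i]]_n) (A : 'M[R[i]]_n).
Hypotheses (S_nat : S `<=` natural_points G) (SA : nonidentity S A).

(** By induction on the entry sum: either [B] is in the Apery set, or [B] is [A] times an element of
    [S] of smaller entry sum, already factored. *)
Lemma Apery_l_generating : generating_set S (Apery_l S A `|` [set A]).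
Proof.
have [SAA /eqP A_neq1] := SA.
split=> [B [[]|->]//|]; apply: (entry_sum_ind S_nat) => B SB IH.
have [SC|nSC] := pselect (S (invmx A *m B)); last first.
  exists [:: B]; rewrite big_seq1; split=> // C.
  by rewrite inE => /eqP ->; left.
have BE : B = A *m (invmx A *m B).
  by rewrite mulKVmx // natural_points_unitmx //; exact: S_nat.
have [|s [sT sE]] := IH _ SC.
  (* Only the [B] on the right is expanded, as the quotient on the left contains [B] too. *)
  rewrite [in ltRHS]BE; apply: entry_sum_lt_mull => //;
    by apply: natural_points_nonneg_unidiagonal; exact: S_nat.
exists (A :: s); rewrite big_cons -sE; split=> // C.
by rewrite inE => /orP[/eqP ->|/sT//]; right.
Qed.

Lemma Apery_r_generating : generating_set S (Apery_r S A `|` [set A]).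
Proof.
have [SAA /eqP A_neq1] := SA.
split=> [B [[]|->]//|]; apply: (entry_sum_ind S_nat) => B SB IH.
have [SC|nSC] := pselect (S (B *m invmx A)); last first.
  exists [:: B]; rewrite big_seq1; split=> // C.
  by rewrite inE => /eqP ->; left.
have BE : B = (B *m invmx A) *m A.
  by rewrite mulmxKV // natural_points_unitmx //; exact: S_nat.
have [|s [sT sE]] := IH _ SC.
  rewrite [in ltRHS]BE; apply: entry_sum_lt_mulr => //;
    by apply: natural_points_nonneg_unidiagonal; exact: S_nat.
(* The factor split off on the right goes to the end of the list, as the product is not
   commutative. *)
exists (rcons s A); rewrite big_rcons /= -sE; split=> // C.
by rewrite mem_rcons inE => /orP[/eqP ->|/sT//]; right.
Qed.

End NaturalPoints.

Theorem theorem3p2 (R : realType) (n : nat) (n_gt0 : (0 < n)%N)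
    (G : set 'M[R[i]]_n) (G_closed : closed_unipotent_subgroup G)
    (GN_fg : finitely_generated (natural_points G))
    (GZ_completion : group_completion (natural_points G) (integer_points G))
    (S : set 'M[R[i]]_n) (S_num : unipotent_numerical_monoid G S)
    (A : 'M[R[i]]_n) (SA : nonidentity S A) :
  generating_set S (Apery_l S A `|` [set A]) /\
  generating_set S (Apery_r S A `|` [set A]).
Proof.
case: S_num => S_nat _ _ _.
by split; [exact: (Apery_l_generating G_closed)
          | exact: (Apery_r_generating G_closed)].
Qed.
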